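(* Let $R$ be a ring, and let $M$ be a finitely generated right $R$-module with $\mathrm{End}_R(M)=S$. Let $X,Y\in\mathrm{Add}_{\aleph_0}(M)$, and put $P=\mathrm{Hom}_R(M,X)$ and $Q=\mathrm{Hom}_R(M,Y)$. Let $I,J\in\mathcal{T}(S)$, and assume that $P$ is $I$-big, $Q$ is $J$-big, and both $P/PI$ and $Q/QJ$ are finitely generated. Then: (i) $X\cong Y$ if and only if $I=J$ and $P/PI\cong Q/QI$. (ii) $X$ is isomorphic to a direct summand of $Y$ if and only if $I\subseteq J$ and $P/PJ$ is isomorphic to a direct summand of $Q/QJ$. (iii) Let $N\in\mathrm{Add}_{\aleph_0}(M)$ be such that the trace of the projective right $S$-module $\mathrm{Hom}_R(M,N)$ is $I$. Then $X\cong X\oplus N^{(\omega)}$, and $X\in\mathrm{add}(M\oplus N^{(\omega)})$.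
   Context: Rings are associative with $1$, not necessarily commutative. For a module $L$, $\mathrm{add}(L)$ is the class of modules isomorphic to direct summands of finite direct sums of copies of $L$, and $\mathrm{Add}_{\aleph_0}(L)$ is the class of modules isomorphic to direct summands of countable direct sums of copies of $L$. $N^{(\omega)}$ is the direct sum of countably infinitely many copies of $N$. Since $M$ is finitely generated, $\mathrm{Hom}_R(M,X)$ is a countably generated projective right $S$-module for $X\in\mathrm{Add}_{\aleph_0}(M)$. The trace of a projective right $S$-module $P$ is the two-sided ideal $\sum_{f\in\mathrm{Hom}_S(P,S)}f(P)$ of $S$. $\mathcal{T}(S)$ is the set of ideals of $S$ that are traces of countably generated projective right $S$-modules. For an ideal $I$ of $S$, a countably generated projective right $S$-module $P$ is called $I$-big if every countably generated projective right $S$-module $Q$ with $QI=Q$ is a homomorphic image of $P$. *)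

(* Defs.v *)
From HB Require Import structures.
From mathcomp Require Import all_boot all_algebra.
From mathcomp Require Import boolp classical_sets functions cardinality.

Set Implicit Arguments.
Unset Strict Implicit.
Unset Printing Implicit Defensive.

Import GRing.Theory.

Local Open Scope classical_set_scope.
Local Open Scope ring_scope.

(* MathComp only has left modules: a right R-module is a left module over the
   converse ring R^c, and x.r is written r *: x. Rings may be trivial, since
   the endomorphism ring of the zero module is. *)
Notation rmodType R := (lmodType R^c).

Section Modules.
Variable R : pzRingType.
Implicit Types U V W : lmodType R.

(* The submodule generated by A. *)
Definition span V (A : set V) : set V :=
  [set x | exists n (c : 'I_n -> R) (v : 'I_n -> V),
     (forall i, A (v i)) /\ x = \sum_(i < n) c i *: v i].

Definition in_span V (A : set V) : {pred V} := fun x => `[< span A x >].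

Lemma span_submod_closed V (A : set V) : submod_closed (in_span A).
Proof.
split=> [|a x y /asboolP [m [c [v [Av ->]]]] /asboolP [n [d [w [Aw ->]]]]].
  apply/asboolP; exists 0%N, (fun=> 0), (fun=> 0).
  by split=> [[]|]; last by rewrite big_ord0.
apply/asboolP; exists (m + n)%N.
exists (fun i =>
  match fintype.split i with inl j => a * c j | inr j => d j end).
exists (fun i => match fintype.split i with inl j => v j | inr j => w j end).
split=> [i|]; first by case: (fintype.split i).
rewrite big_split_ord scaler_sumr; congr (_ + _); apply: eq_bigr => i _.
  by rewrite (unsplitK (inl i : 'I_m + 'I_n)) scalerA.
by rewrite (unsplitK (inr i : 'I_m + 'I_n)).
Qed.

HB.instance Definition _ V (A : set V) :=
  GRing.isSubmodClosed.Build R V (in_span A) (span_submod_closed A).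

Definition finitely_generated V : Prop :=
  exists n (g : 'I_n -> V), span (range g) = setT.

Definition countably_generated V : Prop :=
  exists g : nat -> V, span (range g) = setT.

Definition isomorphic U V : Prop := exists f : {linear U -> V}, bijective f.

Definition homomorphic_image U V : Prop :=
  exists f : {linear V -> U}, range f = setT.

(* U is isomorphic to a direct summand of V. *)
Definition direct_summand U V : Prop := exists W, isomorphic V (U * W)%type.

Definition projective V : Prop :=
  forall U W (p : {linear U -> W}) (f : {linear V -> W}),
    range p = setT -> exists g : {linear V -> U}, forall x, p (g x) = f x.

End Modules.

(* The quotient of V by the submodule generated by A. *)
Section QuotientModule.
Variables (R : pzRingType) (V : lmodType R) (A : set V).

Let span_zmod := GRing.ZmodClosed.clone V (in_span A) _.

Definition quotient_module : Type := Quotient.quot span_zmod.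

HB.instance Definition _ := GRing.Zmodule.on quotient_module.

Definition quotient_repr (x : quotient_module) : V :=
  repr (x : Quotient.quot span_zmod).

Definition quotient_pi (x : V) : quotient_module :=
  \pi_(Quotient.quot span_zmod)%qT x.

Lemma quotient_reprK : cancel quotient_repr quotient_pi.
Proof. exact: reprK. Qed.

Lemma quotient_piP x y : quotient_pi x = quotient_pi y <-> span A (x - y).
Proof.
split=> [/eqP|Axy]; last apply/eqP; rewrite -(Quotient.idealrBE span_zmod).
  by move/asboolP.
exact/asboolP.
Qed.

Definition quotient_scale (a : R) (x : quotient_module) : quotient_module :=
  quotient_pi (a *: quotient_repr x).

Lemma quotient_scale_pi a (x : V) :
  quotient_scale a (quotient_pi x) = quotient_pi (a *: x).
Proof.
apply/quotient_piP/asboolP; rewrite -scalerBr.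
have := @rpredZ R V (in_span A); apply; apply/asboolP/quotient_piP.
by rewrite quotient_reprK.
Qed.

Lemma quotient_piD x y : quotient_pi (x + y) = quotient_pi x + quotient_pi y.
Proof. exact: (raddfD \pi_(Quotient.quot span_zmod)%qT). Qed.

Lemma quotient_scalerA a b x :
  quotient_scale a (quotient_scale b x) = quotient_scale (a * b) x.
Proof. by rewrite -[x]quotient_reprK !quotient_scale_pi scalerA. Qed.

Lemma quotient_scale1r : left_id 1 quotient_scale.
Proof. by move=> x; rewrite -[x]quotient_reprK quotient_scale_pi scale1r. Qed.

Lemma quotient_scalerDr : right_distributive quotient_scale +%R.
Proof.
move=> a x y; rewrite -[x]quotient_reprK -[y]quotient_reprK -quotient_piD.
by rewrite !quotient_scale_pi scalerDr quotient_piD.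
Qed.

Lemma quotient_scalerDl x : {morph quotient_scale^~ x : a b / a + b}.
Proof.
move=> a b; rewrite -[x]quotient_reprK !quotient_scale_pi.
by rewrite scalerDl quotient_piD.
Qed.

HB.instance Definition _ := GRing.Zmodule_isLmodule.Build R quotient_module
  quotient_scalerA quotient_scale1r quotient_scalerDr quotient_scalerDl.

Lemma quotient_pi_linear : linear quotient_pi.
Proof.
by move=> a x y; rewrite quotient_piD -quotient_scale_pi.
Qed.

HB.instance Definition _ :=
  GRing.isLinear.Build R V quotient_module _ quotient_pi quotient_pi_linear.

End QuotientModule.

(* The direct sum of copies of L indexed by T. *)
Section DirectSum.
Variables (R : pzRingType) (T : Type) (L : lmodType R).

Definition finite_support : {pred T -> L} :=
  fun f => `[< finite_set [set t | f t <> 0] >].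

Lemma finite_support_submod_closed : submod_closed finite_support.
Proof.
split=> [|a f g /asboolP finf /asboolP fing]; apply/asboolP.
  by apply: (sub_finite_set (B := set0)) => // t /=; apply.
apply: (sub_finite_set (B := [set t | f t <> 0] `|` [set t | g t <> 0])).
  move=> t /= h; have [f0|] := EM (f t = 0); last by left.
  right=> g0; apply: h; rewrite /GRing.add/= /GRing.scale/= f0 g0.
  by rewrite scaler0 addr0.
by rewrite finite_setU.
Qed.

HB.instance Definition _ :=
  GRing.isSubmodClosed.Build R (T -> L) finite_support
    finite_support_submod_closed.

Record direct_sum : Type := DirectSum {
  direct_sum_fun :> T -> L;
  direct_sumP : direct_sum_fun \in finite_support }.

HB.instance Definition _ := [isSub for direct_sum_fun].
HB.instance Definition _ := [Choice of direct_sum by <:].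
HB.instance Definition _ := [SubChoice_isSubLmodule of direct_sum by <:].

End DirectSum.

Section AddClasses.
Variables (R : pzRingType) (L : lmodType R).

Definition add_class (X : lmodType R) : Prop :=
  exists n : nat, direct_summand X (direct_sum 'I_n L).

Definition Add_aleph0 (X : lmodType R) : Prop :=
  exists T : countType, direct_summand X (direct_sum T L).

End AddClasses.

Section Hom.
Variable R : pzRingType.
Implicit Types L M X : lmodType R.

Definition HomMod M X : Type := {linear M -> X}.

HB.instance Definition _ M X := gen_eqMixin (HomMod M X).
HB.instance Definition _ M X := gen_choiceMixin (HomMod M X).

Lemma hom_ext M X (f g : HomMod M X) : f =1 g -> f = g.
Proof.
case: f g => f [[cf] [sf]] [g [[cg] [sg]]] /= /funext fg.
case: g / fg cg sg => cg sg.
by rewrite (Prop_irrelevance cf cg) (Prop_irrelevance sf sg).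
Qed.

Definition hom_zero M X : HomMod M X := \0 : {linear M -> X}.
Definition hom_opp M X (f : HomMod M X) : HomMod M X := \- f : {linear M -> X}.
Definition hom_add M X (f g : HomMod M X) : HomMod M X :=
  f \+ g : {linear M -> X}.
Definition hom_comp L M X (f : HomMod M X) (g : HomMod L M) : HomMod L X :=
  f \o g : {linear L -> X}.
Definition hom_id M : HomMod M M := idfun : {linear M -> M}.

Section Zmodule.
Variables M X : lmodType R.

Lemma hom_addA : associative (@hom_add M X).
Proof. by move=> f g h; apply: hom_ext => x /=; rewrite addrA. Qed.

Lemma hom_addC : commutative (@hom_add M X).
Proof. by move=> f g; apply: hom_ext => x /=; rewrite addrC. Qed.

Lemma hom_add0 : left_id (hom_zero M X) (@hom_add M X).
Proof. by move=> f; apply: hom_ext => x /=; rewrite add0r. Qed.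

Lemma hom_addN : left_inverse (hom_zero M X) (@hom_opp M X) (@hom_add M X).
Proof. by move=> f; apply: hom_ext => x /=; rewrite addNr. Qed.

HB.instance Definition _ :=
  GRing.isZmodule.Build (HomMod M X) hom_addA hom_addC hom_add0 hom_addN.
End Zmodule.

Lemma hom_compA L M X Y (f : HomMod X Y) (g : HomMod M X) (h : HomMod L M) :
  hom_comp f (hom_comp g h) = hom_comp (hom_comp f g) h.
Proof. exact: hom_ext. Qed.

Lemma hom_comp1 M X (f : HomMod M X) : hom_comp f (hom_id M) = f.
Proof. exact: hom_ext. Qed.

Lemma hom_comp1l M X (f : HomMod M X) : hom_comp (hom_id X) f = f.
Proof. exact: hom_ext. Qed.

Lemma hom_compDl L M X (f g : HomMod M X) (h : HomMod L M) :
  hom_comp (f + g) h = hom_comp f h + hom_comp g h.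
Proof. exact: hom_ext. Qed.

Lemma hom_compDr L M X (f : HomMod M X) (g h : HomMod L M) :
  hom_comp f (g + h) = hom_comp f g + hom_comp f h.
Proof. by apply: hom_ext => x /=; rewrite raddfD. Qed.

Definition EndRing M : Type := HomMod M M.

HB.instance Definition _ M := GRing.Zmodule.on (EndRing M).
HB.instance Definition _ M := GRing.Zmodule_isPzRing.Build (EndRing M)
  (@hom_compA M M M M) (@hom_comp1l M M) (@hom_comp1 M M)
  (@hom_compDl M M M) (@hom_compDr M M M).

(* HomMod M X is a right module over EndRing M: f.s is f composed after s. *)
Section RightModule.
Variables M X : lmodType R.

Definition hom_scale (s : (EndRing M)^c) (f : HomMod M X) : HomMod M X :=
  hom_comp f s.

Lemma hom_scaleA (s t : (EndRing M)^c) (f : HomMod M X) :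
  hom_scale s (hom_scale t f) = hom_scale (s * t) f.
Proof. exact: hom_ext. Qed.

Lemma hom_scale1 : left_id 1 hom_scale.
Proof. by move=> f; apply: hom_ext. Qed.

Lemma hom_scaleDr : right_distributive hom_scale +%R.
Proof. by move=> s f g; apply: hom_ext. Qed.

Lemma hom_scaleDl (f : HomMod M X) : {morph hom_scale^~ f : s t / s + t}.
Proof. by move=> s t; apply: hom_compDr. Qed.

HB.instance Definition _ :=
  GRing.Zmodule_isLmodule.Build (EndRing M)^c (HomMod M X)
    hom_scaleA hom_scale1 hom_scaleDr hom_scaleDl.
End RightModule.
End Hom.

Section Ideals.
Variable S : pzRingType.
Implicit Types (P Q : rmodType S) (I : set S).

(* The sum of the images f(P) is the right ideal generated by their union. *)
Definition trace_ideal P : set S :=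
  span [set (f x : (S^c)^o) |
    f in [set: {linear P -> (S^c)^o}] & x in [set: P]].

Definition trace_ideals : set (set S) :=
  [set I | exists P : rmodType S,
     [/\ countably_generated P, projective P & I = trace_ideal P]].

(* PI and P/PI; PI is the submodule generated by the x.s, x in P and s in I,
   which for an ideal I consists of the finite sums of such elements. *)
Definition mul_gens P I : set P :=
  [set (s : S^c) *: x | s in I & x in [set: P]].
Arguments mul_gens P I : clear implicits.

Definition mul_ideal P I : set P := span (mul_gens P I).
Arguments mul_ideal P I : clear implicits.

Definition quotient_by_ideal P I : rmodType S :=
  quotient_module (mul_gens P I).

(* Meant for countably generated projective P, which is not built in: HomMod M X
   is such a module when M is finitely generated and Add_aleph0 M X. *)
Definition ideal_big I P : Prop :=
  forall Q, countably_generated Q -> projective Q ->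
    mul_ideal Q I = setT -> homomorphic_image Q P.

End Ideals.

Arguments mul_gens {S} P I.
Arguments mul_ideal {S} P I.

(* Main.v *)
Require Import Defs.
From HB Require Import structures.
From mathcomp Require Import all_boot all_algebra.
From mathcomp Require Import boolp classical_sets functions cardinality.
From mathcomp Require Import fsbigop.

(** Since M is finitely generated, Hom(M,-) is fully faithful on the modules of
    Add_aleph0(M) and sends them to countably generated projective S-modules
    (hom_full, hom_faithful, has_dual_basis_hom_regular), so everything can be
    decided for P and Q. Membership in Add_aleph0(L) is used throughout in the
    form of a countable dual basis: maps a_t : L -> X and b_t : X -> L, almost
    all b_t x being zero for each x, with x the sum of the a_t (b_t x). For
    L = S this is the usual characterization of countably generated projective
    modules. Being a summand is used as being a retract.

    Two facts about an ideal I that is the trace of K carry the proof.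

    Covering (trace_cover): K I = K, and Q I is the sum of the images of the
    maps K -> Q. Hence if f : P -> Q is onto modulo Q I and Q is countably
    generated, then f extends to an epimorphism from P + K^(w) onto Q.

    Absorption (big_absorb): if P is I-big and U is countably generated
    projective with U I = U, then P + U is isomorphic to P. By covering, U is a
    summand of C = K^(w), so that U + C^(w) is isomorphic to C^(w) by an
    Eilenberg swindle; and C^(w) is a summand of P because P is I-big.

    For (i), lift an isomorphism P/PI -> Q/QI to f : P -> Q and cover: P + K^(w)
    maps onto Q, with a kernel Q' such that Q' I = Q', because f is injective
    modulo I. As Q is projective, P + K^(w) is isomorphic to Q + Q', and
    absorption on both sides gives P isomorphic to Q. For (ii), lift the
    projection of Q/QJ onto P/PJ and cover: P is a summand of Q + K^(w), that
    is of Q by absorption. The second part of (iii) is covering applied to a map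
    S^n -> P, and the first part is absorption.

    Conversely the ideals are determined by the modules (big_ideal_sub): if Q is
    I-big, with I the trace of K, and Q/QJ is finitely generated, then so is the
    image K^(w)/K^(w)J, an infinite direct sum of copies of K/KJ. Hence K = K J
    and I is contained in J. *)

Set Implicit Arguments.
Unset Strict Implicit.
Unset Printing Implicit Defensive.

Import GRing.Theory.

Local Open Scope classical_set_scope.
Local Open Scope ring_scope.

Local Notation span := Defs.span.

(** * Finitely supported sums *)

Section FiniteSums.
Variables (T : choiceType) (V : zmodType).
Implicit Types F G : T -> V.

Definition finitely_supported F := finite_set [set t | F t <> 0].

Lemma finitely_supportedP F :
  finitely_supported F -> exists s, uniq s /\ forall t, t \notin s -> F t = 0.
Proof.
move=> /finite_seqP [s Fs]; exists (undup s).
split=> [|t]; first exact: undup_uniq.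
rewrite mem_undup => /negP ts; apply: contrapT => Ft; apply: ts.
by have : [set t | F t <> 0] t by []; rewrite Fs.
Qed.

Lemma finitely_supported_seq F (s : seq T) :
  (forall t, t \notin s -> F t = 0) -> finitely_supported F.
Proof.
move=> Fs; apply: (sub_finite_set (B := [set` s])) => // t /= Ft.
by apply: contrapT => /negP /Fs.
Qed.

Lemma fsum_seq F (s : seq T) : uniq s -> (forall t, t \notin s -> F t = 0) ->
  \sum_(t \in [set: T]) F t = \sum_(t <- s) F t.
Proof.
move=> us Fs; rewrite (fsbigE s)// => [|t _ /Fs //].
by apply: eq_bigl => t; rewrite in_setT.
Qed.

Lemma fsum1 F t0 : (forall t, t != t0 -> F t = 0) ->
  \sum_(t \in [set: T]) F t = F t0.
Proof.
move=> F0; rewrite (@fsum_seq _ [:: t0]) ?big_seq1// => t.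
by rewrite inE => /F0.
Qed.

Lemma fsumD F G : finitely_supported F -> finitely_supported G ->
  \sum_(t \in [set: T]) (F t + G t) =
  \sum_(t \in [set: T]) F t + \sum_(t \in [set: T]) G t.
Proof.
move=> /finitely_supportedP [s [_ Fs]] /finitely_supportedP [r [_ Gr]].
have us : uniq (undup (s ++ r)) by exact: undup_uniq.
have sr t : t \notin undup (s ++ r) -> F t = 0 /\ G t = 0.
  by rewrite mem_undup mem_cat negb_or => /andP [/Fs -> /Gr ->].
rewrite !(fsum_seq us); first by rewrite big_split.
- by move=> t /sr [].
- by move=> t /sr [].
- by move=> t /sr [-> ->]; rewrite addr0.
Qed.

End FiniteSums.

Lemma raddf_fsum (T : choiceType) (V W : zmodType) (f : {additive V -> W})
    (F : T -> V) : finitely_supported F ->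
  f (\sum_(t \in [set: T]) F t) = \sum_(t \in [set: T]) f (F t).
Proof.
move=> /finitely_supportedP [s [us Fs]]; rewrite !(fsum_seq us) ?raddf_sum//.
by move=> t /Fs ->; rewrite raddf0.
Qed.

(** * Isomorphisms, retracts and kernels *)

Section Retracts.
Variable R : pzRingType.
Implicit Types U V W : lmodType R.

Definition mk_linear U V (f : U -> V) (fL : linear f) : {linear U -> V} :=
  HB.pack f (GRing.isLinear.Build R U V *:%R f fL).

Definition retract U V :=
  exists (s : {linear U -> V}) (r : {linear V -> U}), cancel s r.

Lemma retract_refl U : retract U U.
Proof. by exists idfun, idfun. Qed.

Lemma retract_trans U V W : retract U V -> retract V W -> retract U W.
Proof.
move=> [s [r rs]] [s' [r' rs']]; exists (s' \o s), (r \o r').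
by move=> x /=; rewrite rs'.
Qed.

Lemma isomorphic_inverse U V : isomorphic U V ->
  exists (f : {linear U -> V}) (g : {linear V -> U}), cancel f g /\ cancel g f.
Proof.
move=> [f [g fK gK]]; have gL : linear g.
  by move=> a x y; apply: (can_inj fK); rewrite linearP !gK.
by exists f, (mk_linear gL).
Qed.

Lemma isomorphic_refl U : isomorphic U U.
Proof. by exists idfun, id. Qed.

Lemma isomorphic_sym U V : isomorphic U V -> isomorphic V U.
Proof. by move=> /isomorphic_inverse [f [g [fK gK]]]; exists g, f. Qed.

Lemma isomorphic_trans U V W :
  isomorphic U V -> isomorphic V W -> isomorphic U W.
Proof. by move=> [f fb] [g gb]; exists (g \o f); exact: bij_comp. Qed.

Lemma isomorphic_retract U V : isomorphic U V -> retract U V.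
Proof. by move=> /isomorphic_inverse [f [g [fK _]]]; exists f, g. Qed.

Lemma prod_inl_linear U V : linear (fun x : U => (x, 0 : V)).
Proof.
by move=> a x y; apply: injective_projections; rewrite //= scaler0 addr0.
Qed.

Lemma prod_inr_linear U V : linear (fun y : V => (0 : U, y)).
Proof.
by move=> a x y; apply: injective_projections; rewrite //= scaler0 addr0.
Qed.

Definition prod_inl U V : {linear U -> (U * V)%type} :=
  mk_linear (@prod_inl_linear U V).
Definition prod_inr U V : {linear V -> (U * V)%type} :=
  mk_linear (@prod_inr_linear U V).

Lemma prod_inlr U V (x : U) (y : V) :
  (x, y) = prod_inl U V x + prod_inr U V y.
Proof. by apply: injective_projections; rewrite /= ?addr0 ?add0r. Qed.

Lemma copair_linear U V W (f : {linear U -> W}) (g : {linear V -> W}) :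
  linear (fun z : U * V => f z.1 + g z.2).
Proof. by move=> a x y; rewrite !linearP scalerDr addrACA. Qed.

Definition copair U V W (f : {linear U -> W}) (g : {linear V -> W}) :
  {linear (U * V)%type -> W} := mk_linear (copair_linear f g).

Lemma prod_map_linear U U' V V' (f : {linear U -> U'}) (g : {linear V -> V'}) :
  linear (fun z : U * V => (f z.1, g z.2)).
Proof. by move=> a x y; rewrite /= !linearP. Qed.

Definition prod_map U U' V V' (f : {linear U -> U'}) (g : {linear V -> V'}) :
  {linear (U * V)%type -> (U' * V')%type} := mk_linear (prod_map_linear f g).

Lemma prod_mapK U U' V V' (f : {linear U -> U'}) (g : {linear V -> V'})
    (f' : {linear U' -> U}) (g' : {linear V' -> V}) :
  cancel f f' -> cancel g g' -> cancel (prod_map f g) (prod_map f' g').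
Proof. by move=> fK gK [x y]; rewrite /= fK gK. Qed.

Lemma isomorphic_prod U U' V V' : isomorphic U U' -> isomorphic V V' ->
  isomorphic (U * V)%type (U' * V')%type.
Proof.
move=> /isomorphic_inverse [f [f' [fK f'K]]].
move=> /isomorphic_inverse [g [g' [gK g'K]]].
by exists (prod_map f g), (prod_map f' g'); exact: prod_mapK.
Qed.

Lemma retract_prod U U' V V' : retract U U' -> retract V V' ->
  retract (U * V)%type (U' * V')%type.
Proof.
move=> [f [f' fK]] [g [g' gK]].
by exists (prod_map f g), (prod_map f' g'); exact: prod_mapK.
Qed.

Lemma isomorphic_prod_rot U V W :
  isomorphic ((U * V) * W)%type ((W * U) * V)%type.
Proof.
have hL : linear (fun x : (U * V) * W => (x.2, x.1.1, x.1.2)) by [].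
by exists (mk_linear hL), (fun x => (x.1.2, x.2, x.1.1)) => [[[]]|[[]]].
Qed.

Section Kernel.
Variables (U V : lmodType R) (f : {linear U -> V}).

Definition in_kernel : {pred U} := fun x => `[< f x = 0 >].

Lemma in_kernel_submod_closed : submod_closed in_kernel.
Proof.
split=> [|a x y /asboolP fx /asboolP fy]; apply/asboolP; first exact: raddf0.
by rewrite linearP fx fy scaler0 addr0.
Qed.

HB.instance Definition _ :=
  GRing.isSubmodClosed.Build R U in_kernel in_kernel_submod_closed.

Record kernel : Type := Kernel {
  kernel_val : U;
  kernelP : kernel_val \in in_kernel }.

HB.instance Definition _ := [isSub for kernel_val].
HB.instance Definition _ := [Choice of kernel by <:].
HB.instance Definition _ := [SubChoice_isSubLmodule of kernel by <:].

Lemma kernel0 (x : kernel) : f (kernel_val x) = 0.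
Proof. by have /asboolP := kernelP x. Qed.

End Kernel.

(** The explicit projection onto the kernel serves to transport a property of
    elements of V, such as lying in V I, to the complement of U. *)
Lemma split_epi U V (s : {linear U -> V}) (r : {linear V -> U}) : cancel s r ->
  isomorphic V (U * kernel r)%type /\
  exists p : {linear V -> kernel r}, forall x, kernel_val (p x) = x - s (r x).
Proof.
move=> rs.
have pk x : (x - s (r x)) \in in_kernel r.
  by apply/asboolP; rewrite linearB /= rs subrr.
pose p x := Kernel (pk x).
have pL : linear p.
  move=> a x y; apply: val_inj => /=.
  by rewrite (linearP r) (linearP s) scalerBr opprD addrACA.
split; last by exists (mk_linear pL).
have hL : linear (fun x => (r x, p x)) by move=> a x y; rewrite linearP pL.
exists (mk_linear hL), (fun u => s u.1 + kernel_val u.2) => [x|[u k]] /=.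
  by rewrite addrC subrK.
congr (_, _); first by rewrite linearD rs kernel0 addr0.
by apply: val_inj; rewrite /= linearD rs kernel0 addr0 addrC addKr.
Qed.

Lemma direct_summandP U V : direct_summand U V <-> retract U V.
Proof.
split=> [[W /isomorphic_inverse [f [g [fK gK]]]]|[s [r rs]]]; last first.
  by exists (kernel r); have [] := split_epi rs.
by exists (g \o prod_inl U W), (fst \o f) => x /=; rewrite gK.
Qed.

End Retracts.

(** * Direct sums and dual bases *)

Section Families.
Variables (R : pzRingType) (T : countType).
Implicit Types X Y L : lmodType R.

Definition locally_finite X L (b : T -> {linear X -> L}) :=
  forall x, finitely_supported (fun t => b t x).

Lemma locally_finite_postcomp X L Y (b : T -> {linear X -> L})
    (c : T -> {linear L -> Y}) :
  locally_finite b -> locally_finite (fun t => c t \o b t).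
Proof.
move=> lb x; have /finitely_supportedP [s [_ bs]] := lb x.
by apply: (@finitely_supported_seq _ _ _ s) => t /bs /= ->; rewrite raddf0.
Qed.

Lemma sum_family_linear X Y (h : T -> {linear X -> Y}) : locally_finite h ->
  linear (fun x => \sum_(t \in [set: T]) h t x).
Proof.
move=> lh a x y.
have lah : finitely_supported (fun t => a *: h t x).
  have /finitely_supportedP [s [_ hs]] := lh x.
  by apply: (@finitely_supported_seq _ _ _ s) => t /hs ->; rewrite scaler0.
rewrite (raddf_fsum ( *:%R a : {additive Y -> Y}) (lh x)) -(fsumD lah (lh y)).
by apply: eq_fsbigr => t _; rewrite linearP.
Qed.

Definition sum_family X Y (h : T -> {linear X -> Y}) (lh : locally_finite h) :=
  mk_linear (sum_family_linear lh).

Lemma sum_family_seq X Y (h : T -> {linear X -> Y}) (lh : locally_finite h)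
    (s : seq T) x : uniq s -> (forall t, t \notin s -> h t x = 0) ->
  sum_family lh x = \sum_(t <- s) h t x.
Proof. exact: fsum_seq. Qed.

Definition dual_basis L X (a : T -> {linear L -> X})
    (b : T -> {linear X -> L}) :=
  locally_finite b /\ forall x, x = \sum_(t \in [set: T]) a t (b t x).

Lemma dual_basis_expand L X (a : T -> {linear L -> X})
    (b : T -> {linear X -> L}) x : dual_basis a b ->
  exists s, [/\ uniq s, forall t, t \notin s -> b t x = 0 &
    x = \sum_(t <- s) a t (b t x)].
Proof.
move=> [lb ab]; have [s [us bs]] := finitely_supportedP (lb x).
exists s; split=> //; rewrite {1}[x]ab (fsum_seq us) // => t /bs ->.
by rewrite raddf0.
Qed.

Lemma dual_basis_of_expand L X (a : T -> {linear L -> X})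
    (b : T -> {linear X -> L}) :
  (forall x, exists s, [/\ uniq s, forall t, t \notin s -> b t x = 0 &
    x = \sum_(t <- s) a t (b t x)]) ->
  dual_basis a b.
Proof.
move=> H; split=> x; have [s [us bs E]] := H x.
  exact: finitely_supported_seq bs.
by rewrite (fsum_seq us) => // t /bs ->; rewrite raddf0.
Qed.

Lemma dsum_proj_linear L t : linear (fun x : direct_sum T L => x t).
Proof. by []. Qed.

Definition dsum_proj L t : {linear direct_sum T L -> L} :=
  mk_linear (@dsum_proj_linear L t).

Lemma dsum_proj_locally_finite L : locally_finite (@dsum_proj L).
Proof. by move=> x; have /asboolP := direct_sumP x. Qed.

Section IntoSum.
Variables (X L : lmodType R) (b : T -> {linear X -> L}).
Hypothesis lb : locally_finite b.

Lemma to_dsum_subproof x : (fun t => b t x) \in @Defs.finite_support R T L.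
Proof. exact/asboolP/lb. Qed.

Definition to_dsum_fun x := DirectSum (to_dsum_subproof x).

Lemma to_dsum_linear : linear to_dsum_fun.
Proof.
by move=> a x y; apply: val_inj; apply/funext => t; exact: linearP.
Qed.

Definition to_dsum : {linear X -> direct_sum T L} := mk_linear to_dsum_linear.

Lemma to_dsumE x t : to_dsum x t = b t x.
Proof. by []. Qed.

End IntoSum.

Definition delta L (t t' : T) : {linear L -> L} :=
  if t' == t then (idfun : {linear L -> L}) else (\0 : {linear L -> L}).

Lemma delta_locally_finite L t : locally_finite (@delta L t).
Proof.
move=> x; apply: (@finitely_supported_seq _ _ _ [:: t]) => t'.
by rewrite inE /delta => /negPf ->.
Qed.

Definition dsum_inj L t : {linear L -> direct_sum T L} :=
  to_dsum (@delta_locally_finite L t).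

Lemma dsum_injE L t t' x : dsum_inj L t x t' = if t' == t then x else 0.
Proof. by rewrite /dsum_inj to_dsumE /delta; case: eqP. Qed.

Lemma dsum_dual_basis L : dual_basis (@dsum_inj L) (@dsum_proj L).
Proof.
apply: dual_basis_of_expand => x.
have [s [us xs]] := finitely_supportedP (@dsum_proj_locally_finite L x).
exists s; split=> //; apply: val_inj; apply/funext => t.
rewrite -[RHS]/(dsum_proj L t _) linear_sum.
have projE t' : dsum_proj L t (dsum_inj L t' (dsum_proj L t' x)) =
    if t == t' then dsum_proj L t' x else 0 by exact: dsum_injE.
rewrite -(fsum_seq us) => [|t' /xs t'x]; last by rewrite projE t'x if_same.
rewrite (fsum1 (t0 := t)) => [|t' t't]; rewrite projE ?eqxx//.
by rewrite eq_sym (negPf t't).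
Qed.

Lemma eq_on_dsum_inj L Y (f g : {linear direct_sum T L -> Y}) :
  (forall t x, f (dsum_inj L t x) = g (dsum_inj L t x)) -> f =1 g.
Proof.
move=> fg x; have [s [_ _ ->]] := dual_basis_expand x (dsum_dual_basis L).
by rewrite !linear_sum; apply: eq_bigr => t _; rewrite fg.
Qed.

Definition from_dsum L X (a : T -> {linear L -> X}) :
    {linear direct_sum T L -> X} :=
  sum_family (locally_finite_postcomp a (@dsum_proj_locally_finite L)).

Lemma from_dsum_inj L X (a : T -> {linear L -> X}) t x :
  from_dsum a (dsum_inj L t x) = a t x.
Proof.
rewrite -[LHS]/(\sum_(t' \in [set: T]) a t' (dsum_inj L t x t')).
rewrite (fsum1 (t0 := t)) => [|t' /negPf t't]; rewrite dsum_injE ?eqxx//.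
by rewrite t't raddf0.
Qed.

Lemma dual_basis_retract L X (a : T -> {linear L -> X}) b :
  dual_basis a b -> retract X (direct_sum T L).
Proof.
by move=> [lb ab]; exists (to_dsum lb), (from_dsum a) => x; rewrite [RHS]ab.
Qed.

End Families.

Section DualBases.
Variable R : pzRingType.
Implicit Types X Y L : lmodType R.

Definition has_dual_basis L X := exists (T : countType)
  (a : T -> {linear L -> X}) (b : T -> {linear X -> L}), dual_basis a b.

Lemma has_dual_basis_dsum (T : countType) L : has_dual_basis L (direct_sum T L).
Proof.
by exists T, (@dsum_inj R T L), (@dsum_proj R T L); exact: dsum_dual_basis.
Qed.

Lemma has_dual_basis_retract L X Y :
  retract X Y -> has_dual_basis L Y -> has_dual_basis L X.
Proof.
move=> [s [r rs]] [T [a [b ab]]].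
exists T, (fun t => r \o a t), (fun t => b t \o s).
apply: dual_basis_of_expand => x.
have [l [ul bl E]] := dual_basis_expand (s x) ab; exists l; split=> //.
by rewrite -{1}[x]rs {1}E linear_sum.
Qed.

Lemma has_dual_basis_refl L : has_dual_basis L L.
Proof.
exists unit, (fun=> idfun), (fun=> idfun); apply: dual_basis_of_expand => x.
by exists [:: tt]; split=> [|[] //|]; rewrite ?big_seq1.
Qed.

Lemma has_dual_basis_prod L X Y : has_dual_basis L X -> has_dual_basis L Y ->
  has_dual_basis L (X * Y)%type.
Proof.
move=> [T [a [b ab]]] [T' [a' [b' ab']]].
pose c (t : T + T') : {linear L -> (X * Y)%type} :=
  match t with inl t => prod_inl X Y \o a t | inr t => prod_inr X Y \o a' t end.
pose d (t : T + T') : {linear (X * Y)%type -> L} :=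
  match t with inl t => b t \o fst | inr t => b' t \o snd end.
exists (T + T')%type, c, d.
apply: dual_basis_of_expand => -[x y].
have [s [us bs Ex]] := dual_basis_expand x ab.
have [s' [us' bs' Ey]] := dual_basis_expand y ab'.
exists ([seq inl t | t <- s] ++ [seq inr t | t <- s']); split.
- rewrite cat_uniq !map_inj_uniq ?us ?us' => [|? ? [] //|? ? [] //].
  by rewrite andbT; apply/hasPn => _ /mapP [t _ ->]; apply/mapP => -[].
- move=> [] t; rewrite mem_cat negb_or => /andP [/negP t1 /negP t2] /=.
    by apply: bs; apply/negP => ts; apply: t1; apply: map_f.
  by apply: bs'; apply/negP => ts; apply: t2; apply: map_f.
- rewrite big_cat !big_map /= -(raddf_sum (prod_inl X Y)) -Ex.
  by rewrite -(raddf_sum (prod_inr X Y)) -Ey; exact: prod_inlr.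
Qed.

Lemma has_dual_basis_trans L X Y : has_dual_basis L X -> has_dual_basis X Y ->
  has_dual_basis L Y.
Proof.
move=> [T [a [b [lb ab]]]] [T' [a' [b' ab']]].
exists (T' * T)%type, (fun t => a' t.1 \o a t.2), (fun t => b t.2 \o b' t.1).
apply: dual_basis_of_expand => y.
have [s' [us' bs' Ey]] := dual_basis_expand y ab'.
(* One finite support s serves all the coordinates b' t' y with t' in s', so
   that the support of the composite family is a rectangle. *)
have [s [us bs]] : exists s, uniq s /\
    forall t, t \notin s -> forall t', t' \in s' -> b t (b' t' y) = 0.
  elim: (s') => [|t' r [s [us IH]]]; first by exists nil.
  have [s1 [us1 bs1]] := finitely_supportedP (lb (b' t' y)).
  exists (undup (s ++ s1)); split=> [|t]; first exact: undup_uniq.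
  rewrite mem_undup mem_cat negb_or => /andP [ts ts1] t2.
  by rewrite inE => /orP [/eqP ->|]; [exact: bs1|exact: IH].
exists [seq (t', t) | t' <- s', t <- s]; split.
- by rewrite allpairs_uniq// => -[? ?] [? ?].
- move=> [t' t] /=.
  have [ts'|/bs' -> _] := boolP (t' \in s'); last by rewrite raddf0.
  have [ts /negP []|/bs -> //] := boolP (t \in s).
  by apply/allpairsP; exists (t', t).
- rewrite big_allpairs_dep /= {1}Ey big_seq [RHS]big_seq.
  apply: eq_bigr => t' ts'; rewrite -raddf_sum -fsum_seq -?ab// => t /bs -> //.
  by rewrite raddf0.
Qed.

(** Every countable index set embeds in nat. *)
Lemma has_dual_basis_retract_nat L X :
  has_dual_basis L X -> retract X (direct_sum nat L).
Proof.
move=> [T [a [b ab]]].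
pose c n : {linear L -> X} :=
  if @pickle_inv T n is Some t then a t else (\0 : {linear L -> X}).
pose d n : {linear X -> L} :=
  if @pickle_inv T n is Some t then b t else (\0 : {linear X -> L}).
apply: (dual_basis_retract (a := c) (b := d)).
apply: dual_basis_of_expand => x; have [s [us bs E]] := dual_basis_expand x ab.
exists [seq pickle t | t <- s]; split.
- by rewrite (map_inj_uniq (pcan_inj (@pickleK T))).
- move=> n ns; rewrite /d; case En : (@pickle_inv T n) => [t|//].
  apply: bs; apply: contra ns => ts; apply/mapP; exists t => //.
  by have := @pickle_invK T n; rewrite En.
- rewrite big_map {1}E; apply: eq_bigr => t _.
  by rewrite /c /d pickleK_inv.
Qed.

End DualBases.

(** * The Eilenberg swindle *)

Section Swindle.
Variables (R : pzRingType) (U B : lmodType R).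
Variables (s : {linear U -> B}) (r : {linear B -> U}) (rs : cancel s r).

(* With B = U + W, a pair (u, x) is sent to the sequence whose W-component is
   that of x and whose U-component is that of x shifted by one place, the
   vacated place 0 receiving u. *)
Let shift (p : U * direct_sum nat B) n : B :=
  if n is m.+1 then p.2 m else s p.1.

Let push n (p : U * direct_sum nat B) : B :=
  s (r (shift p n)) + (p.2 n - s (r (p.2 n))).

Let push_linear n : linear (push n).
Proof.
have shL : linear (shift ^~ n) by case: n => [|n] a x y //; exact: linearP.
move=> a x y; rewrite /push shL.
rewrite !(linearP r) !(linearP s) opprD !scalerDr scalerN [RHS]addrACA.
by congr (_ + _); rewrite addrACA.
Qed.

Let push_lf : locally_finite (fun n => mk_linear (push_linear n)).
Proof.
move=> [u x].
have /finitely_supportedP [l [_ xl]] := @dsum_proj_locally_finite R nat B x.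
apply: (@finitely_supported_seq _ _ _ (0%N :: l ++ [seq n.+1 | n <- l])) => n.
rewrite inE mem_cat !negb_or => /and3P [n0 nl nl1] /=; rewrite /push /=.
have -> : shift (u, x) n = 0.
  case: n n0 {nl} nl1 => // n _ nl1; apply: xl.
  by apply: contra nl1 => nl; apply: map_f.
have -> : x n = 0 by exact: xl.
by rewrite !linear0 !addr0.
Qed.

Let pull n (y : direct_sum nat B) : B := s (r (y n.+1)) + (y n - s (r (y n))).

Let pull_linear n : linear (pull n).
Proof.
move=> a x y; rewrite /pull.
rewrite !(linearP r) !(linearP s) opprD !scalerDr scalerN [RHS]addrACA.
by congr (_ + _); rewrite addrACA.
Qed.

Let pull_lf : locally_finite (fun n => mk_linear (pull_linear n)).
Proof.
move=> y.
have /finitely_supportedP [l [_ yl]] := @dsum_proj_locally_finite R nat B y.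
apply: (@finitely_supported_seq _ _ _ (l ++ [seq n.-1 | n <- l])) => n.
rewrite mem_cat negb_or => /andP [nl nl1] /=; rewrite /pull.
have -> : y n.+1 = 0.
  by apply: yl; apply: contra nl1 => nl1; apply/mapP; exists n.+1.
have -> : y n = 0 by exact: yl.
by rewrite !linear0 !addr0.
Qed.

(** The swindle in the form U + (U + W)^(w) = (U + W)^(w), made explicit so as
    to need neither the complement W nor any rearrangement of infinite sums. *)
Lemma swindle : isomorphic (U * direct_sum nat B)%type (direct_sum nat B).
Proof.
have r0 x : r (x - s (r x)) = 0 by rewrite linearB /= rs subrr.
have rpush p n : r (push n p) = r (shift p n).
  by rewrite /push linearD r0 addr0 rs.
have rpull y n : r (pull n y) = r (y n.+1).
  by rewrite /pull linearD r0 addr0 rs.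
exists (to_dsum push_lf),
  (fun y : direct_sum nat B => (r (y 0%N), to_dsum pull_lf y)) => [[u x]|y] /=.
  congr (_, _); first by rewrite /= (rpush _ 0%N) /= rs.
  apply: val_inj; apply/funext => n /=; rewrite /pull /= !rpush /= {1}/push /=.
  by rewrite [X in _ + X]addrAC subrr add0r addrCA subrr addr0.
apply: val_inj; apply/funext => n /=; rewrite /push /=.
rewrite rpull /pull.
by case: n => [|n] /=; rewrite ?rs ?rpull;
  rewrite [X in _ + X]addrAC subrr add0r addrCA subrr addr0.
Qed.

End Swindle.

(** * Generators, projectivity and quotients *)

Section Spans.
Variable R : pzRingType.
Implicit Types U V W : lmodType R.

Lemma span_gen V (A : set V) : A `<=` span A.
Proof.
move=> x Ax; exists 1%N, (fun=> 1), (fun=> x); split=> //.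
by rewrite big_ord1 scale1r.
Qed.

Lemma spanZD V (A : set V) c x y : span A x -> span A y -> span A (c *: x + y).
Proof.
move=> /asboolP Ax /asboolP Ay; apply/asboolP.
by have [_] := span_submod_closed A; apply.
Qed.

Lemma span0 V (A : set V) : span A 0.
Proof. by apply/asboolP; have [] := span_submod_closed A. Qed.

Lemma spanD V (A : set V) x y : span A x -> span A y -> span A (x + y).
Proof. by move=> Ax Ay; rewrite -[x]scale1r; exact: spanZD. Qed.

Lemma spanZ V (A : set V) c x : span A x -> span A (c *: x).
Proof.
by move=> Ax; rewrite -[_ *: _]addr0; apply: spanZD => //; exact: span0.
Qed.

Lemma spanN V (A : set V) x : span A x -> span A (- x).
Proof. by rewrite -scaleN1r; exact: spanZ. Qed.

Lemma span_sum V (A : set V) (I : Type) (s : seq I) (F : I -> V) :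
  (forall i, span A (F i)) -> span A (\sum_(i <- s) F i).
Proof.
by move=> AF; elim/big_ind: _ => //; [exact: span0|exact: spanD].
Qed.

Lemma span_image U V (f : {linear U -> V}) (A : set U) (B : set V) :
  (forall x, A x -> span B (f x)) -> forall x, span A x -> span B (f x).
Proof.
move=> AB x [n [c [v [Av ->]]]]; rewrite linear_sum; apply: span_sum => i.
by rewrite linearZ; apply: spanZ; apply: AB.
Qed.

Lemma span_range U V (f : {linear U -> V}) (A : set V) :
  A `<=` range f -> span A `<=` range f.
Proof.
move=> Af x [n [c [v [Av ->]]]].
have /choice [u fu] : forall i, exists u, f u = v i.
  by move=> i; have [u _ <-] := Af _ (Av i); exists u.
exists (\sum_i c i *: u i) => //; rewrite linear_sum.
by apply: eq_bigr => i _; rewrite linearZ /= fu.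
Qed.

Lemma scale_by_linear V (v : V) : linear (fun c : R^o => (c : R) *: v).
Proof. by move=> a x y; rewrite scalerDl scalerA. Qed.

Definition scale_by V (v : V) : {linear R^o -> V} :=
  mk_linear (scale_by_linear v).

Lemma regular_linearE V (f : {linear R^o -> V}) (c : R^o) :
  f c = (c : R) *: f 1.
Proof. by rewrite -[in LHS](mulr1 c) (linearZ_LR f). Qed.

Lemma rangeTP U V (f : {linear U -> V}) :
  range f = setT <-> forall y, exists x, f x = y.
Proof.
split=> [fT y|fs].
  by have : setT y by []; rewrite -fT => -[x _ <-]; exists x.
by apply/seteqP; split=> // y _; have [x <-] := fs y; exists x.
Qed.

Lemma epi_section U V (f : {linear U -> V}) : projective V -> range f = setT ->
  exists s : {linear V -> U}, cancel s f.
Proof. by move=> pV fs; have [s sf] := pV _ _ f idfun fs; exists s. Qed.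

Lemma from_dsum_scale_range (T : countType) V (g : T -> V) :
  span (range g) `<=` range (from_dsum (fun t => scale_by (g t))).
Proof.
apply: span_range => _ [t _ <-]; exists (dsum_inj R^o t 1) => //.
by rewrite from_dsum_inj /= scale1r.
Qed.

Definition cg_projective V := countably_generated V /\ projective V.

(** The dual basis lemma: generators give an epimorphism from a sum of copies of
    the ring, and a section of it gives the coordinates. Conversely a map is
    lifted by lifting the images of the a_t 1. *)
Lemma cg_projectiveP V : cg_projective V <-> has_dual_basis R^o V.
Proof.
split=> [[[g gV] pV]|[T [a [b ab]]]]; last split.
- have fT : range (from_dsum (fun n => scale_by (g n))) = setT.
    by apply/seteqP; split=> // x _; apply: from_dsum_scale_range; rewrite gV.
  have [s sf] := epi_section pV fT.
  apply: has_dual_basis_retract (has_dual_basis_dsum nat R^o).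
  by exists s, (from_dsum (fun n => scale_by (g n))).
- exists (fun n => if @unpickle T n is Some t then a t 1 else 0).
  apply/seteqP; split=> // x _; have [s [_ _ ->]] := dual_basis_expand x ab.
  apply: span_sum => t; rewrite regular_linearE.
  by apply: spanZ; apply: span_gen; exists (pickle t) => //; rewrite pickleK.
- move=> U W p f /rangeTP ps.
  have /choice [u pu] : forall t, exists u, p u = f (a t 1).
    by move=> t; exact: ps.
  have [lb _] := ab.
  have lc := locally_finite_postcomp (fun t => scale_by (u t)) lb.
  exists (sum_family lc) => x; have [s [us bs E]] := dual_basis_expand x ab.
  rewrite (sum_family_seq lc us) => [|t /bs /= ->]; last by rewrite scale0r.
  rewrite [in RHS]E !linear_sum; apply: eq_bigr => t _ /=.
  by rewrite [a t _]regular_linearE !linearZ /= pu.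
Qed.

Definition quotient_proj V (A : set V) : {linear V -> quotient_module A} :=
  quotient_pi A.

Lemma quotient_proj_surjective V (A : set V) : range (quotient_proj A) = setT.
Proof.
by apply/rangeTP => y; exists (quotient_repr y); exact: quotient_reprK.
Qed.

Lemma quotient_proj_eq0 V (A : set V) x : quotient_proj A x = 0 <-> span A x.
Proof.
by rewrite -(linear0 (quotient_proj A)) -{2}[x]subr0; exact: quotient_piP.
Qed.

Lemma fg_quotient_lift V (A : set V) :
  finitely_generated (quotient_module A) ->
  exists n (v : 'I_n -> V), forall x, exists c : direct_sum 'I_n R^o,
    span A (x - from_dsum (fun i => scale_by (v i)) c).
Proof.
move=> [n [g gV]]; exists n, (fun i => quotient_repr (g i)) => x.
have : span (range g) (quotient_proj A x) by rewrite gV.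
move=> /from_dsum_scale_range [c _ fc]; exists c; apply/quotient_piP.
rewrite -[LHS]/(quotient_proj A x) -fc.
pose h := from_dsum (fun i => scale_by (quotient_repr (g i))).
rewrite -[RHS]/((quotient_proj A \o h) c); apply: eq_on_dsum_inj => i z.
rewrite -[RHS]/(quotient_proj A (h _)) /h !from_dsum_inj /=.
by rewrite linearZ /= quotient_reprK.
Qed.

End Spans.

(** * Trace ideals and big projective modules *)

Section Ideals.
Variable S : pzRingType.
Implicit Types P Q U V K X : rmodType S.

Lemma mul_ideal_gen P (I : set S) (s : S^c) (x : P) :
  I s -> mul_ideal P I (s *: x).
Proof. by move=> Is; apply: span_gen; exists s => //; exists x. Qed.

Lemma mul_ideal_map P Q (f : {linear P -> Q}) (I : set S) x :
  mul_ideal P I x -> mul_ideal Q I (f x).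
Proof.
apply: span_image => _ [s Is] [y _] <-.
by rewrite linearZ; exact: mul_ideal_gen.
Qed.

Lemma mul_ideal_full K X (I : set S) : has_dual_basis K X ->
  mul_ideal K I = setT -> mul_ideal X I = setT.
Proof.
move=> [T [a [b ab]]] KI; apply/seteqP; split=> // x _.
have [s [_ _ ->]] := dual_basis_expand x ab.
by apply: span_sum => t; apply: mul_ideal_map; rewrite KI.
Qed.

Lemma trace_gen K (f : {linear K -> (S^c)^o}) x : trace_ideal K (f x).
Proof. by apply: span_gen; exists f => //; exists x. Qed.

(** The coordinates of an element in a dual basis lie in the trace. *)
Lemma mul_trace K :
  has_dual_basis (S^c)^o K -> mul_ideal K (trace_ideal K) = setT.
Proof.
move=> [T [a [b ab]]]; apply/seteqP; split=> // x _.
have [s [_ _ ->]] := dual_basis_expand x ab.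
apply: span_sum => t; rewrite regular_linearE.
by apply: mul_ideal_gen; exact: trace_gen.
Qed.

(** Multiplication in S^c is reversed: s *: x is the product x s in S, so this
    says that the trace, a right ideal by definition, is also a left ideal. *)
Lemma trace_mull K (s : S^c) (x : (S^c)^o) :
  trace_ideal K s -> trace_ideal K (s *: x).
Proof.
apply: (span_image (f := scale_by x)) => _ [f _] [y _] <-.
exact: (trace_gen (scale_by x \o f)).
Qed.

Lemma trace_sub K K' :
  mul_ideal K (trace_ideal K') = setT -> trace_ideal K `<=` trace_ideal K'.
Proof.
move=> KI x; apply: (span_image (f := idfun)) => _ [f _] [y _] <- /=.
have : mul_ideal K (trace_ideal K') y by rewrite KI.
apply: span_image => _ [s Is] [k _] <-.
by rewrite linearZ; exact: trace_mull.
Qed.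

(** Q Tr(K) is the sum of the images of the maps K -> Q, because x f(k) is the
    image of k under f : K -> S followed by the map S -> Q, s |-> x s. *)
Lemma mul_trace_image K Q z : mul_ideal Q (trace_ideal K) z ->
  exists (g : {linear direct_sum nat K -> Q}) c, g c = z.
Proof.
have gens : mul_gens Q (trace_ideal K) `<=`
    span [set (h x : Q) | h in [set: {linear K -> Q}] & x in [set: K]].
  move=> _ [s Is] [x _] <-.
  apply: (span_image (f := scale_by x)) Is => _ [h _] [k _] <-.
  by apply: span_gen; exists (scale_by x \o h) => //; exists k.
move=> /(span_image (f := idfun) gens) /= [m [c [v [hv ->]]]].
have /choice [h /choice [k hk]] :
    forall i, exists h : {linear K -> Q}, exists k, h k = v i.
  by move=> i; have [h _ [k _ <-]] := hv i; exists h, k.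
have [s [r rs]] := has_dual_basis_retract_nat (has_dual_basis_dsum 'I_m K).
exists (from_dsum h \o r), (s (\sum_i dsum_inj K i (c i *: k i))).
rewrite -[LHS]/(from_dsum h (r _)) rs linear_sum; apply: eq_bigr => i _.
by rewrite from_dsum_inj linearZ /= hk.
Qed.

(** A generator of Q differs from an element of f(P) by an element of Q Tr(K),
    which is reached from one copy of K^(w); countably many generators need
    countably many copies, and these fit in a single K^(w). *)
Lemma trace_cover K P Q (f : {linear P -> Q}) : countably_generated Q ->
  (forall q, exists p, mul_ideal Q (trace_ideal K) (q - f p)) ->
  exists g : {linear direct_sum nat K -> Q}, range (copair f g) = setT.
Proof.
move=> [y yQ] fQ; pose C : rmodType S := direct_sum nat K.
have /choice [p /choice [g /choice [c yE]]] : forall n, exists p,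
    exists g : {linear C -> Q}, exists c, g c = y n - f p.
  move=> n; have [p yp] := fQ (y n); exists p; exact: mul_trace_image yp.
have CC := has_dual_basis_trans (has_dual_basis_dsum nat K)
                                (has_dual_basis_dsum nat C).
have [s [r rs]] := has_dual_basis_retract_nat CC.
exists (from_dsum g \o r); apply/seteqP; split=> // q _.
have : span (range y) q by rewrite yQ.
apply: span_range => _ [n _ <-]; exists (p n, s (dsum_inj C n (c n))) => //.
rewrite -[LHS]/(f (p n) + from_dsum g (r (s (dsum_inj C n (c n))))).
by rewrite rs from_dsum_inj yE addrC subrK.
Qed.

Lemma mul_trace_full_retract K U : has_dual_basis (S^c)^o U ->
  mul_ideal U (trace_ideal K) = setT -> retract U (direct_sum nat K).
Proof.
move=> /cg_projectiveP [cU pU] UI.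
have [|g gT] := @trace_cover K U U \0 cU.
  by move=> q; exists 0; rewrite UI.
have gs : range g = setT.
  apply/rangeTP => u; have [[p c] <-] := (rangeTP _).1 gT u.
  by exists c; rewrite /= add0r.
by have [s sg] := epi_section pU gs; exists s, g.
Qed.

Lemma trace_sum_full K (I : set S) :
  I = trace_ideal K -> has_dual_basis (S^c)^o K ->
  has_dual_basis (S^c)^o (direct_sum nat K) /\
  mul_ideal (direct_sum nat K) I = setT.
Proof.
move=> -> hK; have hC := has_dual_basis_dsum nat K.
split; first exact: has_dual_basis_trans hC.
exact: mul_ideal_full hC (mul_trace hK).
Qed.

Lemma big_absorb (I : set S) P U : trace_ideals I -> ideal_big I P ->
  has_dual_basis (S^c)^o U -> mul_ideal U I = setT -> isomorphic (P * U)%type P.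
Proof.
move=> [K [cK pK IK]] bigP hU UI.
have hK : has_dual_basis (S^c)^o K by apply/cg_projectiveP.
have [hC CI] := trace_sum_full IK hK.
pose C : rmodType S := direct_sum nat K.
pose D : rmodType S := direct_sum nat C.
have CD := has_dual_basis_dsum nat C.
have [cD pD] := (cg_projectiveP D).2 (has_dual_basis_trans hC CD).
have [q qs] := bigP D cD pD (mul_ideal_full CD CI).
have [s sq] := epi_section pD qs.
have [PDW _] := split_epi sq.
have UD : isomorphic (U * D)%type D.
  have [s' [r' rs']] : retract U C.
    by apply: mul_trace_full_retract; rewrite -?IK.
  exact: swindle rs'.
apply: isomorphic_trans (isomorphic_sym PDW).
apply: isomorphic_trans (isomorphic_prod PDW (isomorphic_refl U)) _.
apply: isomorphic_trans (isomorphic_prod_rot _ _ _) _.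
exact: isomorphic_prod UD (isomorphic_refl _).
Qed.

Lemma big_iso_of_quotient (I : set S) P Q : trace_ideals I ->
  has_dual_basis (S^c)^o P -> has_dual_basis (S^c)^o Q ->
  ideal_big I P -> ideal_big I Q ->
  isomorphic (quotient_by_ideal P I) (quotient_by_ideal Q I) -> isomorphic P Q.
Proof.
move=> trI hP hQ bigP bigQ /isomorphic_inverse [phi [psi [phiK psiK]]].
have [K [cK pK IK]] := trI.
have hK : has_dual_basis (S^c)^o K by apply/cg_projectiveP.
have [hC CI] := trace_sum_full IK hK.
have [[_ pP] [cQ pQ]] := ((cg_projectiveP P).2 hP, (cg_projectiveP Q).2 hQ).
pose piP : {linear P -> quotient_by_ideal P I} := quotient_proj _.
pose piQ : {linear Q -> quotient_by_ideal Q I} := quotient_proj _.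
have [f fphi] := pP _ _ piQ (phi \o piP) (quotient_proj_surjective _).
have fQ q : exists p, mul_ideal Q (trace_ideal K) (q - f p).
  exists (quotient_repr (psi (piQ q))); rewrite -IK.
  apply/quotient_piP; apply: esym; apply: etrans (fphi _) _ => /=.
  by rewrite /piP /= quotient_reprK psiK.
have [g hT] := trace_cover cQ fQ.
have [s sh] := epi_section pQ hT.
have [PCQ [pr prE]] := split_epi sh.
have PC : isomorphic (P * direct_sum nat K)%type P := big_absorb trI bigP hC CI.
pose Q' : rmodType S := kernel (copair f g).
have hQ' : has_dual_basis (S^c)^o Q'.
  apply: has_dual_basis_retract hP.
  apply: retract_trans (isomorphic_retract PC).
  apply: retract_trans (isomorphic_retract (isomorphic_sym PCQ)).
  by exists (prod_inr _ _), snd.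
have Q'I : mul_ideal Q' I = setT.
  apply/seteqP; split=> // k _.
  have -> : k = pr (kernel_val k).
    by apply: val_inj; rewrite /= prE kernel0 linear0 subr0.
  apply: mul_ideal_map; have := kernel0 k; case: (kernel_val k) => p c /= fg0.
  rewrite prod_inlr; apply: spanD; last by apply: mul_ideal_map; rewrite CI.
  (* As f p = - g c lies in Q I and f is injective modulo I, p lies in P I. *)
  apply: mul_ideal_map; apply/quotient_proj_eq0.
  rewrite -/(piP p) -[piP p]phiK -[phi _]/((phi \o piP) p) -fphi.
  suff -> : piQ (f p) = 0 by rewrite linear0.
  apply/quotient_proj_eq0; rewrite -(addrK (g c) (f p)) fg0 add0r.
  by apply: spanN; apply: mul_ideal_map; rewrite CI.
apply: isomorphic_trans (isomorphic_sym PC) _.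
apply: isomorphic_trans PCQ _.
exact: big_absorb trI bigQ hQ' Q'I.
Qed.

Lemma big_retract_of_quotient (J : set S) P Q : trace_ideals J ->
  has_dual_basis (S^c)^o P -> has_dual_basis (S^c)^o Q -> ideal_big J Q ->
  retract (quotient_by_ideal P J) (quotient_by_ideal Q J) -> retract P Q.
Proof.
move=> trJ hP hQ bigQ [s [r rs]].
have [K [cK pK JK]] := trJ.
have hK : has_dual_basis (S^c)^o K by apply/cg_projectiveP.
have [hC CJ] := trace_sum_full JK hK.
have [[cP pP] [_ pQ]] := ((cg_projectiveP P).2 hP, (cg_projectiveP Q).2 hQ).
pose piP : {linear P -> quotient_by_ideal P J} := quotient_proj _.
pose piQ : {linear Q -> quotient_by_ideal Q J} := quotient_proj _.
have [f fr] := pQ _ _ piP (r \o piQ) (quotient_proj_surjective _).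
have fP p : exists q, mul_ideal P (trace_ideal K) (p - f q).
  exists (quotient_repr (s (piP p))); rewrite -JK.
  apply/quotient_piP; apply: esym; apply: etrans (fr _) _ => /=.
  by rewrite /piQ /= quotient_reprK rs.
have [g hT] := trace_cover cP fP.
have [t th] := epi_section pP hT.
apply: retract_trans (isomorphic_retract (big_absorb trJ bigQ hC CJ)).
by exists t, (copair f g).
Qed.

Lemma big_of_retract (I : set S) P Q :
  ideal_big I P -> retract P Q -> ideal_big I Q.
Proof.
move=> bigP [s [r rs]] V cV pV VI; have [f /rangeTP fV] := bigP V cV pV VI.
exists (f \o r); apply/rangeTP => v; have [p fp] := fV v.
by exists (s p); rewrite /= rs.
Qed.

Lemma direct_sum_bound K (x : direct_sum nat K) :
  exists b, forall n, (b <= n)%N -> x n = 0.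
Proof.
have /finitely_supportedP [s [_ xs]] := @dsum_proj_locally_finite _ nat K x.
exists (\max_(n <- s) n).+1 => n sn; apply: xs; apply/negP => ns.
have : (n <= \max_(m <- s) m)%N.
  exact: (leq_bigmax_seq (P := xpredT) (F := id)).
by rewrite leqNgt sn.
Qed.

(** With I' = Tr(K'), the images in K^(w) of finitely many generators of Q
    modulo Q I' vanish from some coordinate N on. The element with k in place N
    is the image of some q, hence is congruent modulo K^(w) I' to an element
    whose coordinate N is zero, so that k lies in K I'. Thus K = K I'. *)
Lemma sum_image_trace_sub K K' Q :
  finitely_generated (quotient_by_ideal Q (trace_ideal K')) ->
  homomorphic_image (direct_sum nat K) Q -> trace_ideal K `<=` trace_ideal K'.
Proof.
move=> /fg_quotient_lift [n [v vQ]] [f /rangeTP fs]; apply: trace_sub.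
have /choice [b bv] := fun i => direct_sum_bound (f (v i)).
pose N := (\max_i b i)%N.
apply/seteqP; split=> // k _.
have [q fq] := fs (dsum_inj K N k); have [c qc] := vQ q.
have -> : k = dsum_proj K N (f q).
  by rewrite fq -[RHS]/(dsum_inj K N k N) dsum_injE eqxx.
pose h := from_dsum (fun i => scale_by (v i)).
rewrite -[q](subrK (h c)) (linearD f) (linearD (dsum_proj K N)).
have -> : dsum_proj K N (f (h c)) = 0.
  rewrite -[LHS]/((dsum_proj K N \o f \o h) c).
  rewrite -[RHS]/((\0 : {linear direct_sum 'I_n (S^c)^o -> K}) c).
  apply: eq_on_dsum_inj => i z.
  rewrite -[LHS]/(dsum_proj K N (f (h _))) from_dsum_inj /=.
  by rewrite linearZ -[LHS]/(z *: (f (v i) N)) bv ?scaler0// leq_bigmax.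
by rewrite addr0; do 2!apply: mul_ideal_map.
Qed.

Lemma big_ideal_sub (I J : set S) Q : trace_ideals I -> trace_ideals J ->
  finitely_generated (quotient_by_ideal Q J) -> ideal_big I Q -> I `<=` J.
Proof.
move=> [K [cK pK IK]] [K' [_ _ ->]] fgQ bigQ; rewrite {1}IK.
have hK : has_dual_basis (S^c)^o K by apply/cg_projectiveP.
have [hC CI] := trace_sum_full IK hK.
apply: sum_image_trace_sub fgQ _.
by have [cC pC] := (cg_projectiveP _).2 hC; exact: bigQ.
Qed.

Section QuotientMap.
Variables (I : set S) (P Q : rmodType S) (f : {linear P -> Q}).

Lemma quotient_map_linear : linear (fun x : quotient_by_ideal P I =>
  quotient_pi (mul_gens Q I) (f (quotient_repr x)) : quotient_by_ideal Q I).
Proof.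
move=> a x y; rewrite -!linearP; apply/quotient_piP; rewrite -linearB.
apply: mul_ideal_map; apply/quotient_piP.
by rewrite linearP /= !quotient_reprK.
Qed.

Definition quotient_map := mk_linear quotient_map_linear.

Lemma quotient_map_pi x : quotient_map (quotient_pi _ x) = quotient_pi _ (f x).
Proof.
apply/quotient_piP; rewrite -linearB; apply: mul_ideal_map.
by apply/quotient_piP; rewrite quotient_reprK.
Qed.
End QuotientMap.

Lemma quotient_mapK I P Q (f : {linear P -> Q}) (g : {linear Q -> P}) :
  cancel f g -> cancel (quotient_map I f) (quotient_map I g).
Proof.
by move=> fK x; rewrite -[x]quotient_reprK !quotient_map_pi fK.
Qed.

End Ideals.

(** * The functor Hom(M,-) *)

Section HomFunctor.
Variables (R : pzRingType) (M : lmodType R).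
Implicit Types X Y Z N L : lmodType R.
Local Notation S := (EndRing M).

Lemma hom_post_linear X Y (h : {linear X -> Y}) :
  linear (fun u : HomMod M X => hom_comp (h : HomMod X Y) u).
Proof. by move=> a u v; apply: hom_ext => x; rewrite /= linearD. Qed.

Definition hom_post X Y (h : {linear X -> Y}) :
  {linear HomMod M X -> HomMod M Y} := mk_linear (hom_post_linear h).

Lemma hom_postE X Y (h : {linear X -> Y}) (u : HomMod M X) x :
  (hom_post h u : {linear M -> Y}) x = h ((u : {linear M -> X}) x).
Proof. by []. Qed.

Lemma hom_postK X Y (f : {linear X -> Y}) (g : {linear Y -> X}) :
  cancel f g -> cancel (hom_post f) (hom_post g).
Proof. by move=> fK u; apply: hom_ext => x; exact: fK. Qed.

Lemma hom_sumE (T : Type) X (s : seq T) (F : T -> HomMod M X) (x : M) :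
  (\sum_(t <- s) F t : {linear M -> X}) x =
  \sum_(t <- s) (F t : {linear M -> X}) x.
Proof.
exact: (big_morph (fun u : HomMod M X => (u : {linear M -> X}) x)).
Qed.

Lemma isomorphic_hom X Y :
  isomorphic X Y -> isomorphic (HomMod M X) (HomMod M Y).
Proof.
move=> /isomorphic_inverse [f [g [fK gK]]].
by exists (hom_post f), (hom_post g); exact: hom_postK.
Qed.

Lemma retract_hom X Y : retract X Y -> retract (HomMod M X) (HomMod M Y).
Proof.
by move=> [s [r rs]]; exists (hom_post s), (hom_post r); exact: hom_postK.
Qed.

Lemma hom_prod X Y :
  isomorphic (HomMod M X * HomMod M Y)%type (HomMod M (X * Y)%type).
Proof.
pose pX : {linear (X * Y)%type -> X} := fst.
pose pY : {linear (X * Y)%type -> Y} := snd.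
exists (copair (hom_post (prod_inl X Y)) (hom_post (prod_inr X Y))),
  (fun w => (hom_post pX w, hom_post pY w)) => [[u v]|w].
  by congr (_, _); apply: hom_ext => x; rewrite /= ?addr0 ?add0r.
apply: hom_ext => x; apply: etrans (esym (prod_inlr _ _)) _.
exact: esym (surjective_pairing _).
Qed.

Hypothesis fgM : finitely_generated M.

(** A map from M meets only the finitely many coordinates that the generators
    of M meet: this is what the finite generation of M is for. *)
Lemma hom_supported (T : countType) X L (b : T -> {linear X -> L}) :
  locally_finite b -> forall u : HomMod M X, exists s, uniq s /\
    forall t, t \notin s -> hom_post (b t) u = 0.
Proof.
move=> lb u; have [n [g gM]] := fgM.
have /choice [l lP] :=
  fun i => finitely_supportedP (lb ((u : {linear M -> X}) (g i))).
exists (undup (flatten [seq l i | i <- enum 'I_n])); split=> [|t].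
  exact: undup_uniq.
rewrite mem_undup => tl; apply: hom_ext => x.
have : span (range g) x by rewrite gM.
move=> [k [c [v [vg ->]]]]; rewrite !linear_sum; apply: eq_bigr => j _.
have [i _ <-] := vg j; rewrite !linearZ; congr (_ *: _).
have [_] := lP i; apply; apply: contra tl => tl.
by apply/flattenP; exists (l i) => //; apply: map_f; rewrite mem_enum.
Qed.

Lemma dual_basis_hom (T : countType) N Z (a : T -> {linear N -> Z})
    (b : T -> {linear Z -> N}) : dual_basis a b ->
  dual_basis (fun t => hom_post (a t)) (fun t => hom_post (b t)).
Proof.
move=> [lb ab]; apply: dual_basis_of_expand => u.
have [s [us bs]] := hom_supported lb u; exists s; split=> //.
apply: hom_ext => x; rewrite hom_sumE [LHS]ab (fsum_seq us) // => t /bs tb.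
by rewrite -hom_postE tb /= linear0.
Qed.

Lemma has_dual_basis_hom N Z :
  has_dual_basis N Z -> has_dual_basis (HomMod M N) (HomMod M Z).
Proof.
move=> [T [a [b ab]]].
by exists T, (fun t => hom_post (a t)), (fun t => hom_post (b t));
  exact: dual_basis_hom.
Qed.

Lemma has_dual_basis_hom_regular X :
  has_dual_basis M X -> has_dual_basis (S^c)^o (HomMod M X).
Proof.
move=> /has_dual_basis_hom; apply: has_dual_basis_trans.
apply: (has_dual_basis_retract _ (has_dual_basis_refl _)).
apply: isomorphic_retract.
have idL : @GRing.linear_for S^c (HomMod M M) (S^c)^o *:%R id by [].
by exists (mk_linear idL), id.
Qed.

(** A map phi is determined by its values on the a_t, as every u is the sum of
    the a_t s_t with s_t the endomorphism b_t u; so h must be the sum of the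
    phi(a_t) b_t. *)
Lemma hom_full X Y (phi : {linear HomMod M X -> HomMod M Y}) :
  has_dual_basis M X -> exists h : {linear X -> Y}, hom_post h =1 phi.
Proof.
move=> [T [a [b ab]]]; have [lb _] := ab.
pose c t : {linear M -> Y} := phi (a t : HomMod M X).
exists (sum_family (locally_finite_postcomp c lb)) => u.
have [s [us bs]] := hom_supported lb u.
have uE : u = \sum_(t <- s) (hom_post (b t) u : S^c) *: (a t : HomMod M X).
  apply: hom_ext => x; rewrite hom_sumE [LHS](proj2 ab) (fsum_seq us) //.
  by move=> t /bs tb; rewrite -hom_postE tb /= linear0.
apply: hom_ext => x; rewrite {2}uE linear_sum hom_sumE hom_postE.
rewrite (sum_family_seq _ us) => [|t /bs tb]; last first.
  by rewrite /= -hom_postE tb /= linear0.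
by apply: eq_bigr => t _; rewrite linearZ.
Qed.

Lemma hom_faithful X Y (f g : {linear X -> Y}) : has_dual_basis M X ->
  hom_post f =1 hom_post g -> f =1 g.
Proof.
move=> [T [a [b ab]]] fg x; have [s [_ _ ->]] := dual_basis_expand x ab.
rewrite !linear_sum; apply: eq_bigr => t _.
by rewrite -[LHS](hom_postE f (a t : HomMod M X)) fg.
Qed.

Lemma hom_post_cancel X Y (f : {linear X -> Y}) (g : {linear Y -> X}) :
  has_dual_basis M X -> cancel (hom_post f) (hom_post g) -> cancel f g.
Proof.
move=> hX fK; apply: (@hom_faithful X X (g \o f) idfun hX) => u.
by rewrite -[RHS]fK; exact: hom_ext.
Qed.

Lemma isomorphic_of_hom X Y : has_dual_basis M X -> has_dual_basis M Y ->
  isomorphic (HomMod M X) (HomMod M Y) -> isomorphic X Y.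
Proof.
move=> hX hY /isomorphic_inverse [p [q [pK qK]]].
have [[f fp] [g gq]] := (hom_full p hX, hom_full q hY).
exists f, g; apply: hom_post_cancel => // u.
  by rewrite fp gq; exact: pK.
by rewrite fp gq; exact: qK.
Qed.

Lemma retract_of_hom X Y : has_dual_basis M X -> has_dual_basis M Y ->
  retract (HomMod M X) (HomMod M Y) -> retract X Y.
Proof.
move=> hX hY [p [q pK]].
have [[f fp] [g gq]] := (hom_full p hX, hom_full q hY).
by exists f, g; apply: hom_post_cancel => // u; rewrite fp gq; exact: pK.
Qed.

Lemma sum_hom_retract N :
  retract (direct_sum nat (HomMod M N)) (HomMod M (direct_sum nat N)).
Proof.
have [lb _] := dual_basis_hom (@dsum_dual_basis R nat N).
exists (from_dsum (fun n => hom_post (@dsum_inj R nat N n))), (to_dsum lb).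
apply: (@eq_on_dsum_inj _ _ _ _ (to_dsum lb \o from_dsum _) idfun) => n u.
apply: val_inj; apply/funext => m.
apply: etrans (congr1 (hom_post (dsum_proj N m)) (from_dsum_inj _ n u)) _.
apply: etrans _ (esym (dsum_injE _ _ _)); apply: hom_ext => x.
by apply: etrans (dsum_injE _ _ _) _; case: eqP.
Qed.

(** Generators v_i of P modulo P Tr(Hom(M,N)) are maps M -> X, and together
    they form a map from M^n; covering completes its image to all of P. *)
Lemma fg_quotient_retract X N :
  has_dual_basis M X -> has_dual_basis M N ->
  finitely_generated
    (quotient_by_ideal (HomMod M X) (trace_ideal (HomMod M N))) ->
  exists n, retract X (direct_sum 'I_n M * direct_sum nat N)%type.
Proof.
move=> hX hN /fg_quotient_lift [n [v vP]]; exists n.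
set P : rmodType S := HomMod M X; set K : rmodType S := HomMod M N.
have [cP pP] := (cg_projectiveP P).2 (has_dual_basis_hom_regular hX).
pose A := direct_sum 'I_n M.
pose F : {linear A -> X} := from_dsum (fun i => v i : {linear M -> X}).
have FP q : exists u, mul_ideal P (trace_ideal K) (q - hom_post F u).
  have [c qc] := vP q.
  pose d := from_dsum (fun i => scale_by (dsum_inj M i : HomMod M A)) c.
  exists d.
  suff -> : hom_post F d = from_dsum (fun i => scale_by (v i)) c by [].
  rewrite -[LHS]/((hom_post F \o from_dsum _) c); apply: eq_on_dsum_inj => i z.
  rewrite -[LHS]/(hom_post F (from_dsum _ _)) !from_dsum_inj.
  by apply: hom_ext => x; rewrite -[LHS]/(F (dsum_inj M i _)) /F from_dsum_inj.
have [g hT] := trace_cover cP FP.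
have [s sf] := epi_section pP hT.
have hNw := has_dual_basis_trans hN (has_dual_basis_dsum nat N).
apply: (retract_of_hom hX (has_dual_basis_prod (has_dual_basis_dsum _ _) hNw)).
apply: (retract_trans (V := (HomMod M A * direct_sum nat K)%type)).
  by exists s, (copair (hom_post F) g).
apply: retract_trans (isomorphic_retract (hom_prod _ _)).
exact: retract_prod (retract_refl _) (sum_hom_retract N).
Qed.

End HomFunctor.

(** * Isomorphisms and summands in Add_aleph0(M) *)

(** The extra copy of M + Z is there to hold Z, also when n = 0. *)
Lemma retract_common_sum (R : pzRingType) (M Z : lmodType R) n :
  retract (direct_sum 'I_n M * Z)%type (direct_sum 'I_n.+1 (M * Z)%type).
Proof.
pose L : lmodType R := (M * Z)%type.
pose s (i : 'I_n.+1) : {linear (direct_sum 'I_n M * Z)%type -> L} :=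
  if unlift ord0 i is Some j then prod_inl M Z \o (dsum_proj M j \o fst)
  else prod_inr M Z \o snd.
have lf (k : nat) (X Y : lmodType R) (b : 'I_k -> {linear X -> Y}) :
    locally_finite b.
  move=> x; apply: (@finitely_supported_seq _ _ _ (enum 'I_k)) => i.
  by rewrite mem_enum.
pose b (j : 'I_n) : {linear direct_sum 'I_n.+1 L -> M} :=
  fst \o dsum_proj L (lift ord0 j).
have rL : linear (fun x : direct_sum 'I_n.+1 L =>
    (to_dsum (lf _ _ _ b) x, (dsum_proj L ord0 x).2)).
  by move=> a x y; rewrite !linearP.
exists (to_dsum (lf _ _ _ s)), (mk_linear rL) => -[m z] /=.
congr (_, _); last by rewrite /s unlift_none.
by apply: val_inj; apply/funext => j /=; rewrite /s liftK.
Qed.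

Lemma Add_aleph0_dual_basis (R : pzRingType) (M X : lmodType R) :
  Add_aleph0 M X -> has_dual_basis M X.
Proof.
move=> [T /direct_summandP XT].
exact: has_dual_basis_retract XT (has_dual_basis_dsum T M).
Qed.

Theorem proposition3p4 (R : pzRingType) (M : rmodType R)
    (hM : finitely_generated M) (X Y : rmodType R)
    (hX : Add_aleph0 M X) (hY : Add_aleph0 M Y)
    (I J : set (EndRing M)) (hI : trace_ideals I) (hJ : trace_ideals J) :
  let P : rmodType (EndRing M) := HomMod M X in
  let Q : rmodType (EndRing M) := HomMod M Y in
  ideal_big I P -> ideal_big J Q ->
  finitely_generated (quotient_by_ideal P I) ->
  finitely_generated (quotient_by_ideal Q J) ->
  [/\ isomorphic X Y <->
        I = J /\ isomorphic (quotient_by_ideal P I) (quotient_by_ideal Q I),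
      direct_summand X Y <->
        I `<=` J /\
        direct_summand (quotient_by_ideal P J) (quotient_by_ideal Q J)
    & forall N : rmodType R, Add_aleph0 M N ->
        trace_ideal (HomMod M N) = I ->
        isomorphic X (X * direct_sum nat N)%type /\
        add_class (M * direct_sum nat N)%type X].
Proof.
move=> P Q bigP bigQ fgP fgQ.
have [dX dY] := (Add_aleph0_dual_basis hX, Add_aleph0_dual_basis hY).
have dP := has_dual_basis_hom_regular hM dX.
have dQ := has_dual_basis_hom_regular hM dY.
split.
- split=> [XY|[IJ PQ]]; last first.
    apply: (isomorphic_of_hom hM dX dY).
    by apply: (big_iso_of_quotient hI dP dQ bigP _ PQ); rewrite IJ.
  have PQ := isomorphic_hom M XY; have QP := isomorphic_sym PQ.
  have [f [g [fK gK]]] := isomorphic_inverse PQ; split; last first.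
    by exists (quotient_map I f), (quotient_map I g); exact: quotient_mapK.
  apply/seteqP; split.
    apply: (big_ideal_sub hI hJ fgQ).
    exact: big_of_retract bigP (isomorphic_retract PQ).
  apply: (big_ideal_sub hJ hI fgP).
  exact: big_of_retract bigQ (isomorphic_retract QP).
- split=> [/direct_summandP XY|[_ /direct_summandP PQ]]; last first.
    apply/direct_summandP/(retract_of_hom hM dX dY).
    exact: big_retract_of_quotient hJ dP dQ bigQ PQ.
  have PQ := retract_hom M XY; split.
    exact: big_ideal_sub hI hJ fgQ (big_of_retract bigP PQ).
  apply/direct_summandP; have [f [g fK]] := PQ.
  by exists (quotient_map J f), (quotient_map J g); exact: quotient_mapK.
- move=> N /Add_aleph0_dual_basis dN trN.
  have dK := has_dual_basis_hom_regular hM dN.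
  have NNw := has_dual_basis_dsum nat N.
  have dNw := has_dual_basis_trans dN NNw.
  split.
    apply: (isomorphic_of_hom hM dX (has_dual_basis_prod dX dNw)).
    apply: isomorphic_sym.
    apply: isomorphic_trans (isomorphic_sym (hom_prod M _ _)) _.
    apply: (big_absorb hI bigP (has_dual_basis_hom_regular hM dNw)).
    rewrite -trN.
    exact: mul_ideal_full (has_dual_basis_hom hM NNw) (mul_trace dK).
  have [n Xn] : exists n, retract X (direct_sum 'I_n M * direct_sum nat N)%type.
    by apply: fg_quotient_retract => //; rewrite trN.
  exists n.+1; apply/direct_summandP.
  exact: retract_trans Xn (retract_common_sum _ _ _).
Qed.
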